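(* Let $q,a,b$ be nonzero complex numbers with $|q|<1$ and $\max\{|ab|,|aq|,|bq|\}<1$. Then $$\frac{(q,ab;q)_\infty}{(aq,bq;q)_\infty}\;{}_3\phi_2\left(\begin{matrix}q/a,\,q/b,\,q\\ q^{3/2},\,-q^{3/2}\end{matrix};q,ab\right)=(1-q)\sum_{n=0}^{\infty}\sum_{j=-n}^{n}\frac{(q/a,q/b;q)_n}{(aq,bq;q)_n}(-ab)^nq^{n^2+n-j(j+1)/2}.$$
   Context: Notation: $(x;q)_0=1$, $(x;q)_n=\prod_{k=0}^{n-1}(1-xq^k)$, $(x;q)_\infty=\prod_{k=0}^\infty(1-xq^k)$, $(x_1,\dots,x_k;q)_n=(x_1;q)_n\cdots(x_k;q)_n$ (also for $n=\infty$), and $${}_3\phi_2\left(\begin{matrix}A_1,A_2,A_3\\ B_1,B_2\end{matrix};q,z\right)=\sum_{n=0}^\infty\frac{(A_1,A_2,A_3;q)_n}{(q,B_1,B_2;q)_n}z^n .$$ Here $q^{3/2}=(q^{1/2})^3$ for a fixed square root $q^{1/2}$ of $q$ (the series does not depend on the choice). *)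

(* Defs.v *)
From HB Require Import structures.
From mathcomp Require Export all_boot all_order all_algebra.
From mathcomp Require Export all_classical all_reals all_analysis.
From mathcomp Require Export complex.
Set Implicit Arguments.
Unset Strict Implicit.
Unset Printing Implicit Defensive.
Export Order.TTheory GRing.Theory Num.Theory.
Export numFieldNormedType.Exports.
#[global] Open Scope ring_scope.

(* [R[i]] carries no topology of its own; seen as a [numFieldType] it gets the
   one induced by its norm, the complex modulus. *)
Definition Cplx (R : realType) : numFieldType := R[i].

Section QSeries.
Variable K : numFieldType.
Implicit Types (x q z : K) (xs ys : seq K) (n : nat).

(* (x; q)_n *)
Definition qpoch x q n : K := \prod_(0 <= k < n) (1 - x * q ^+ k).

(* (x; q)_oo *)
Definition qpochoo x q : K := limn (qpoch x q).

(* (x_1, ..., x_k; q)_n *)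
Definition qpochs xs q n : K := \prod_(x <- xs) qpoch x q n.

(* (x_1, ..., x_k; q)_oo *)
Definition qpochoos xs q : K := \prod_(x <- xs) qpochoo x q.

Definition phi32_term (A1 A2 A3 B1 B2 q z : K) n : K :=
  qpochs [:: A1; A2; A3] q n / qpochs [:: q; B1; B2] q n * z ^+ n.

Definition phi32 (A1 A2 A3 B1 B2 q z : K) : K :=
  limn (series (phi32_term A1 A2 A3 B1 B2 q z)).

(* The inner sum over -n <= j <= n is indexed by k = j + n; the power of q is
   an integer power and [j * (j + 1)] is always even. *)
Definition hecke_term (a b q : K) n : K :=
  \sum_(0 <= k < n.*2.+1)
    let j : int := k%:Z - n%:Z in
    qpochs [:: q / a; q / b] q n / qpochs [:: a * q; b * q] q n
    * (- (a * b)) ^+ n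
    * q ^ ((n ^ 2 + n)%:Z - (j * (j + 1) %/ 2)%Z).

End QSeries.

(* Main.v *)
Require Import Defs.
From mathcomp Require Import ring lra zify.

(* The identity is Bailey's lemma (relative to q, with rho_1 = q/a, rho_2 = q/b) applied
   to the Bailey pair
     alpha_r = (-1)^r q^(r^2+r) sum_(|j| <= r) q^(-j(j+1)/2),
     beta_n = 1 / (q; q^2)_(n+1) = sum_(r <= n) alpha_r / ((q)_(n-r) (q)_(n+r+1)),
   where (1 - q) (q^3; q^2)_n = (q; q^2)_(n+1) absorbs (q^(3/2), -q^(3/2); q)_n.

   The Bailey pair follows by induction on n: a q-Zeilberger certificate D_r
   satisfies
     (1 - q^(2n+3)) c_(n+1,r) - c_(n,r) = D_r - D_(r+1)
   for the weights c_(n,r) of the alternating sum, and after summation by parts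
   the sum of D_r against the increments of sum_(|j| <= r) q^(-j(j+1)/2)
   telescopes to 0.

   Bailey's lemma exchanges the two summations, the inner one being Gauss' sum
     2phi1(A, B; ABz; q, z) = (Az, Bz)_oo / (ABz, z)_oo;
   the latter comes from iterating a first-order q-difference equation in z. *)

Set Implicit Arguments.
Unset Strict Implicit.
Unset Printing Implicit Defensive.

(** * Finite q-Pochhammer symbols and the contiguous relation behind Gauss' sum *)

Section Algebra.
Variable K : numFieldType.
Implicit Types (q x y z A B : K).

Lemma qpoch0 x q : qpoch x q 0 = 1.
Proof. by rewrite /qpoch big_nil. Qed.

Lemma qpochS x q n : qpoch x q n.+1 = qpoch x q n * (1 - x * q ^+ n).
Proof. by rewrite /qpoch big_nat_recr. Qed.

Lemma qpochD x q m n : qpoch x q (m + n) = qpoch x q m * qpoch (x * q ^+ m) q n.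
Proof.
elim: n => [|n IHn]; first by rewrite addn0 qpoch0 mulr1.
by rewrite addnS !qpochS IHn exprD !mulrA.
Qed.

Lemma qpochSl x q n : qpoch x q n.+1 = (1 - x) * qpoch (x * q) q n.
Proof. by rewrite -add1n qpochD qpochS qpoch0 expr0 expr1 mul1r mulr1. Qed.

Lemma qpoch_mulN x q n : qpoch x q n * qpoch (- x) q n = qpoch (x ^+ 2) (q ^+ 2) n.
Proof.
elim: n => [|n IHn]; first by rewrite !qpoch0 mulr1.
rewrite !qpochS -IHn -exprM mulnC exprM; ring.
Qed.

Lemma norm_mulX_lt1 x q k : `|x| < 1 -> `|q| < 1 -> `|x * q ^+ k| < 1.
Proof.
move=> x1 q1; rewrite normrM normrX (le_lt_trans _ x1) // ler_piMr //.
by rewrite exprn_ile1 // ltW.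
Qed.

Lemma subr1_neq0 x : `|x| < 1 -> 1 - x != 0.
Proof.
by move=> x1; rewrite subr_eq0; apply: contraTneq x1 => <-; rewrite normr1 ltxx.
Qed.

Lemma qpoch_neq0 x q n : `|x| < 1 -> `|q| < 1 -> qpoch x q n != 0.
Proof.
move=> x1 q1; elim: n => [|n IHn]; first by rewrite qpoch0 oner_eq0.
by rewrite qpochS mulf_neq0 // subr1_neq0 // norm_mulX_lt1.
Qed.

(** The n-th term of 2phi1(A, B; ABz; q, z). The lower parameter depends on z, so replacing z by zq
    shifts it as well. *)
Definition gauss_term A B q z n : K :=
  qpoch A q n * qpoch B q n / (qpoch q q n * qpoch (A * B * z) q n) * z ^+ n.

(** The q-difference equation in z, stated for partial sums with an explicit remainder so that
    induction on n applies. The remainder tends to 0 with the terms of the series. *)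
Lemma gauss_contiguous A B q z n : `|q| < 1 -> `|A * B * z| < 1 ->
  (1 - A * B * z) * (1 - z) * series (gauss_term A B q z) n
  - (1 - A * z) * (1 - B * z) * series (gauss_term A B q (z * q)) n
  = - ((1 - q ^+ n) * (1 - A * B * z) * gauss_term A B q z n).
Proof.
move=> q1 c1; elim: n => [|n IHn].
  by rewrite !seriesEnat /= !big_nil expr0; ring.
have -> : series (gauss_term A B q z) n.+1
    = series (gauss_term A B q z) n + gauss_term A B q z n.
  by rewrite seriesSr.
have -> : series (gauss_term A B q (z * q)) n.+1
    = series (gauss_term A B q (z * q)) n + gauss_term A B q (z * q) n.
  by rewrite seriesSr.
rewrite [X in X - _]mulrDr [X in _ - X]mulrDr opprD addrACA IHn /gauss_term.
have c0 := subr1_neq0 c1.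
have cn0 := subr1_neq0 (norm_mulX_lt1 n c1 q1).
have qn0 := subr1_neq0 (norm_mulX_lt1 n q1 q1).
have P0 := qpoch_neq0 n c1 q1.
have Q0 := qpoch_neq0 n q1 q1.
have PE : qpoch (A * B * (z * q)) q n
    = qpoch (A * B * z) q n * (1 - A * B * z * q ^+ n) / (1 - A * B * z).
  by rewrite -qpochS qpochSl mulrA [(1 - _) * _ / _]mulrAC divff // mul1r.
rewrite PE !qpochS exprMn !exprS; move: cn0 qn0 P0 Q0.
by move: (q ^+ n) => X *; field; apply/and5P.
Qed.

End Algebra.

(** * Absolute convergence of complex series *)

Section Complex.
Variable R : realType.
Implicit Types (u : (Cplx R)^nat).

Lemma normCplxE (z : Cplx R) : `|z| = (Normc.normc (z : R[i]))%:C%C.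
Proof. by case: z. Qed.

Lemma cvgn_ReIm u : cvgn (fun n => complex.Re (u n : R[i])) ->
  cvgn (fun n => complex.Im (u n : R[i])) -> cvgn u.
Proof.
move=> /cvgrPdist_lt; set x := limn _ => ux /cvgrPdist_lt; set y := limn _ => uy.
apply/cvg_ex; exists ((x +i* y)%C : Cplx R).
apply/cvgrPdist_lt => e e0.
have : 0 < (e : R[i]) by exact: e0.
(* A positive complex number has imaginary part 0, so the radius may be taken real. *)
case: e e0 => e e' e0; rewrite ltcE /= => /andP[/eqP -> {e' e0} e0].
have e20 : 0 < e / 2 by rewrite divr_gt0.
near=> n.
have xn : `|x - complex.Re (u n : R[i])| < e / 2 by near: n; exact: ux.
have yn : `|y - complex.Im (u n : R[i])| < e / 2 by near: n; exact: uy.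
rewrite normCplxE; case: (u n) xn yn => a b /= xn yn.
change ((Num.sqrt ((x - a) ^+ 2 + (y - b) ^+ 2))%:C%C < (e%:C%C : R[i])).
rewrite ltcR -(ger0_norm (ltW e0)) -sqrtr_sqr ltr_sqrt; last by rewrite exprn_gt0.
rewrite -(real_normK (num_real (x - a))) -(real_normK (num_real (y - b))).
have := normr_ge0 (x - a); have := normr_ge0 (y - b); nra.
Unshelve. all: by end_near. Qed.

(** Real and imaginary parts are additive and dominated by the modulus, so both component series
    converge absolutely over the reals. *)
Lemma cvgn_series_le u (M : Cplx R) :
  (forall n, \sum_(0 <= k < n) `|u k| <= M) -> cvgn (series u).
Proof.
move=> uM.
have Mb (f : R[i] -> R) : (forall z : R[i], `|f z| <= Normc.normc z) ->
    (forall z w, f (z + w) = f z + f w) ->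
    cvgn (fun n => f (series u n : R[i])).
  move=> fN fD.
  have f0 : f 0 = 0 by apply: (addIr (f 0)); rewrite -fD !add0r.
  have -> : (fun n => f (series u n : R[i])) = series (fun n => f (u n : R[i])).
    apply/funext => n; rewrite /series /=.
    elim: n => [|n IHn]; first by rewrite !big_nil.
    by rewrite !big_nat_recr //= -IHn fD.
  apply: normed_cvg; apply: nondecreasing_is_cvgn.
    by apply/nondecreasing_seqP => n; rewrite [X in _ <= X]big_nat_recr //= lerDl.
  exists (complex.Re (M : R[i])) => _ [n _ <-] /=; have := uM n.
  pose S := \sum_(0 <= k < n) Normc.normc (u k : R[i]).
  have -> : \sum_(0 <= k < n) `|u k| = S%:C%C.
    by rewrite rmorph_sum; apply: eq_bigr => k _; rewrite normCplxE.
  move=> uMn; have : S%:C%C <= (M : R[i]) by exact: uMn.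
  rewrite lecE => /andP[_] /=; apply: le_trans; apply: ler_sum => k _; exact: fN.
apply: cvgn_ReIm; apply: Mb => //.
- move=> [a b] /=; rewrite -sqrtr_sqr ler_wsqrtr // lerDl sqr_ge0 //.
- by move=> [a b] [c d].
- move=> [a b] /=; rewrite -sqrtr_sqr ler_wsqrtr // lerDr sqr_ge0 //.
- by move=> [a b] [c d].
Qed.

End Complex.

(** * Geometric bounds and infinite q-products *)

Section Limits.
Local Open Scope classical_set_scope.
Variable R : realType.
Implicit Types (q x y z t : Cplx R) (u : (Cplx R)^nat).

Lemma sum_geometric_le (K : numFieldType) (t : K) m n : 0 <= t -> t < 1 ->
  \sum_(m <= k < n) t ^+ k <= t ^+ m / (1 - t).
Proof.
move=> t0 t1; have t1' : 0 < 1 - t by rewrite subr_gt0.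
have [mn|nm] := leqP m n; last first.
  by rewrite big_geq ?(ltnW nm) // divr_ge0 ?exprn_ge0 // ltW.
rewrite ler_pdivlMr // mulrC mulr_sumr.
rewrite (eq_bigr (fun k => - (t ^+ k.+1 - t ^+ k))).
  by rewrite sumrN telescope_sumr // opprB gerBl exprn_ge0.
by move=> k _; rewrite exprS; ring.
Qed.

Lemma cvgn_expr_lt1 t : `|t| < 1 -> t ^+ n @[n --> \oo] --> 0.
Proof.
move=> t1; apply: cvg_series_cvg_0; apply: (@cvgn_series_le R _ (1 / (1 - `|t|))) => n.
under eq_bigr do rewrite normrX.
exact: (sum_geometric_le 0 n (normr_ge0 t) t1).
Qed.

Lemma cvg_le_geometric u l C t : 0 <= t -> t < 1 ->
  (forall n, `|u n - l| <= C * t ^+ n) -> u @ \oo --> l.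
Proof.
move=> t0 t1 uC; have t1' : `|t| < 1 by rewrite ger0_norm.
have /cvgrPdistC_le H : C * t ^+ n @[n --> \oo] --> C * 0.
  by apply: cvgM; [exact: cvg_cst | exact: cvgn_expr_lt1].
apply/cvgrPdistC_le => e e0; near=> n.
rewrite (le_trans (uC n)) //.
have : `|C * t ^+ n - C * 0| <= e by near: n; exact: H.
rewrite mulr0 subr0 ger0_norm // (le_trans _ (uC n)) //.
Unshelve. all: by end_near. Qed.

Lemma cvg_norm_le u l x e N : u @ \oo --> l ->
  (forall n, (N <= n)%N -> `|u n - x| <= e) -> `|l - x| <= e.
Proof.
move=> /cvgrPdist_le ul ue; apply/ler_addgt0Pr => d d0.
near \oo => n.
have -> : l - x = (l - u n) + (u n - x) by rewrite addrA subrK.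
rewrite (le_trans (ler_normD _ _)) // addrC lerD //; last by near: n; exact: ul.
by apply: ue; near: n; exact: nbhs_infty_ge.
Unshelve. all: by end_near. Qed.

(** By 1 + x <= exp x, the product is at most the exponential of a geometric sum. *)
Lemma prod1D_bounded y t : 0 <= y -> 0 <= t -> t < 1 ->
  exists2 M, 0 < M & forall n, \prod_(0 <= k < n) (1 + y * t ^+ k) <= M.
Proof.
case: y => y y'; case: t => t t' y0 t0 t1.
have : 0 <= ((y +i* y')%C : R[i]) by exact: y0.
have : 0 <= ((t +i* t')%C : R[i]) by exact: t0.
have : ((t +i* t')%C : R[i]) < 1 by exact: t1.
rewrite !lecE ltcE /= => /andP[_ {}t1] /andP[/eqP -> {}t0] /andP[/eqP -> {}y0].
exists ((expR (y / (1 - t)))%:C)%C.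
  suff : 0 < (expR (y / (1 - t)))%:C%C :> R[i] by [].
  by rewrite ltcR expR_gt0.
move=> n.
suff : \prod_(0 <= k < n) (1 + y%:C * t%:C ^+ k)%C <= (expR (y / (1 - t)))%:C%C :> R[i].
  by [].
have -> : \prod_(0 <= k < n) (1 + y%:C * t%:C ^+ k)%C
    = (\prod_(0 <= k < n) (1 + y * t ^+ k))%:C%C :> R[i].
  by rewrite rmorph_prod; apply: eq_bigr => k _; rewrite rmorphD rmorphM rmorphXn rmorph1.
rewrite lecR; apply: (@le_trans _ _ (expR (\sum_(0 <= k < n) y * t ^+ k))).
  rewrite expR_sum; apply: ler_prod => k _.
  by rewrite addr_ge0 ?mulr_ge0 ?exprn_ge0 //= expR_ge1Dx.
rewrite ler_expR -mulr_sumr ler_wpM2l //.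
by have := sum_geometric_le 0 n t0 t1; rewrite expr0 div1r.
Qed.

Lemma qpoch_bounded x q : `|q| < 1 -> exists2 M, 0 < M & forall n, `|qpoch x q n| <= M.
Proof.
move=> q1; have [M M0 HM] := prod1D_bounded (normr_ge0 x) (normr_ge0 q) q1.
exists M => // n; apply: le_trans (HM n); rewrite /qpoch normr_prod.
apply: ler_prod => k _; rewrite normr_ge0 /=.
by rewrite (le_trans (ler_normB _ _)) // normr1 normrM normrX.
Qed.

(** One bound serves the whole disc |x| <= t. Each factor is estimated by 1/(1 - tw) <= 1 + tw/(1 -
    t) for 0 <= w <= 1, with w = |q|^k. *)
Lemma qpochV_bounded t q : 0 <= t -> t < 1 -> `|q| < 1 ->
  exists2 M, 0 < M & forall x n, `|x| <= t -> `|(qpoch x q n)^-1| <= M.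
Proof.
move=> t0 t1 q1; have t1' : 0 < 1 - t by rewrite subr_gt0.
have y0 : 0 <= t / (1 - t) by rewrite divr_ge0 // ltW.
have [M M0 HM] := prod1D_bounded y0 (normr_ge0 q) q1.
exists M => // x n xt; apply: le_trans (HM n).
rewrite /qpoch -prodfV normr_prod.
apply: ler_prod => k _; rewrite normr_ge0 /= normfV.
have qk1 : `|q| ^+ k <= 1 by rewrite exprn_ile1 // ltW.
have qk0 : 0 <= `|q| ^+ k by rewrite exprn_ge0.
have tk1 : t * `|q| ^+ k < 1 by rewrite (le_lt_trans _ t1) // ler_piMr.
have d0 : 0 < 1 - t * `|q| ^+ k by rewrite subr_gt0.
have le1 : 1 - t * `|q| ^+ k <= `|1 - x * q ^+ k|.
  rewrite (le_trans _ (lerB_dist _ _)) // normr1 lerD2l lerN2 normrM normrX.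
  by rewrite ler_wpM2r.
apply: (@le_trans _ _ ((1 - t * `|q| ^+ k)^-1)).
  by rewrite lef_pV2 ?posrE // (lt_le_trans d0).
rewrite -div1r ler_pdivrMr //.
rewrite -(ler_pM2l t1').
have -> : (1 - t) * ((1 + t / (1 - t) * `|q| ^+ k) * (1 - t * `|q| ^+ k))
    = (1 - t) * 1 + t * t * (`|q| ^+ k * (1 - `|q| ^+ k)).
  by field; rewrite gt_eqF.
by rewrite lerDl !mulr_ge0 // subr_ge0.
Qed.

(** Consecutive products differ by -xq^k (x; q)_k, which is O(|q|^k), so the telescoping series
    converges absolutely. *)
Lemma cvgn_qpoch x q : `|q| < 1 -> cvgn (qpoch x q).
Proof.
move=> q1; have [M M0 HM] := qpoch_bounded x q1.
have : cvgn (series (telescope (qpoch x q))).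
  apply: (@cvgn_series_le R _ (M * `|x| * (1 / (1 - `|q|)))) => n.
  apply: (@le_trans _ _ (\sum_(0 <= k < n) M * `|x| * `|q| ^+ k)).
    apply: ler_sum => k _; rewrite /telescope /= qpochS.
    have -> : qpoch x q k * (1 - x * q ^+ k) - qpoch x q k
        = - (qpoch x q k * (x * q ^+ k)).
      by ring.
    rewrite normrN !normrM normrX mulrA ler_wpM2r ?exprn_ge0 // ler_wpM2r //.
  rewrite -mulr_sumr ler_wpM2l ?mulr_ge0 ?(ltW M0) //.
  exact: (sum_geometric_le 0 n (normr_ge0 q) q1).
rewrite telescopeK => H.
have -> : qpoch x q = [sequence qpoch x q n - qpoch x q 0]_n + cst (qpoch x q 0).
  by apply/funext => n; rewrite !fctE subrK.
by apply: is_cvgD H _; exact: is_cvg_cst.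
Qed.

(** The reciprocals of the finite products are bounded, so these products cannot tend to 0. *)
Lemma qpochoo_neq0 x q : `|x| < 1 -> `|q| < 1 -> qpochoo x q != 0.
Proof.
move=> x1 q1; have [M M0 HM] := qpochV_bounded (normr_ge0 x) x1 q1.
apply/eqP => x0; have /cvgrPdistC_lt H : qpoch x q @ \oo --> 0.
  by rewrite -x0; exact: cvgn_qpoch.
have Mi0 : 0 < M^-1 by rewrite invr_gt0.
near \oo => n.
have : `|qpoch x q n - 0| < M^-1 by near: n; exact: H.
rewrite subr0 => h; have := HM x n (lexx _); rewrite normfV.
have p0 : 0 < `|qpoch x q n| by rewrite normr_gt0 qpoch_neq0.
by rewrite -[M in _ <= M]invrK lef_pV2 ?posrE // (lt_geF h).
Unshelve. all: by end_near. Qed.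

End Limits.

(** * Gauss' sum for 2phi1 *)

Section Gauss.
Variable R : realType.
Local Open Scope classical_set_scope.
Implicit Types (q x y z t A B : Cplx R) (u : (Cplx R)^nat).

Lemma sum_norm_geometric_le u C t m n : 0 <= t -> t < 1 ->
  (forall n, `|u n| <= C * t ^+ n) ->
  \sum_(m <= k < n) `|u k| <= C * t ^+ m / (1 - t).
Proof.
move=> t0 t1 uC; have C0 : 0 <= C.
  by have := le_trans (normr_ge0 _) (uC 0); rewrite expr0 mulr1.
apply: (@le_trans _ _ (\sum_(m <= k < n) C * t ^+ k)); first exact: ler_sum.
by rewrite -mulr_sumr -mulrA ler_wpM2l // sum_geometric_le.
Qed.

Lemma cvgn_series_geometric_le u C t : 0 <= t -> t < 1 ->
  (forall n, `|u n| <= C * t ^+ n) -> cvgn (series u).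
Proof.
move=> t0 t1 uC; apply: (@cvgn_series_le R _ (C * t ^+ 0 / (1 - t))) => n.
exact: sum_norm_geometric_le.
Qed.

Lemma series_tail_le u C t N : 0 <= t -> t < 1 ->
  (forall n, `|u n| <= C * t ^+ n) ->
  `|limn (series u) - series u N| <= C * t ^+ N / (1 - t).
Proof.
move=> t0 t1 uC; have cvu := cvgn_series_geometric_le t0 t1 uC.
apply: (cvg_norm_le (N := N) cvu) => n Nn.
rewrite sub_series Nn.
by rewrite (le_trans (ler_norm_sum _ _ _)) // sum_norm_geometric_le.
Qed.

(** A single constant works for all shifts zq^k, because the lower parameters ABzq^k stay in the
    disc of radius |ABz|. This uniformity is what allows k to tend to infinity. *)
Lemma gauss_term_bounded A B q z : `|q| < 1 -> `|A * B * z| < 1 ->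
  exists2 M, 0 < M &
    forall k n, `|gauss_term A B q (z * q ^+ k) n| <= M * `|z * q ^+ k| ^+ n.
Proof.
move=> q1 c1.
have [MA MA0 HA] := qpoch_bounded A q1.
have [MB MB0 HB] := qpoch_bounded B q1.
have [Mq Mq0 Hq] := qpochV_bounded (normr_ge0 q) q1 q1.
have [Mc Mc0 Hc] := qpochV_bounded (normr_ge0 (A * B * z)) c1 q1.
exists (MA * MB * (Mq * Mc)); first by rewrite !mulr_gt0.
move=> k n; rewrite /gauss_term normrM normrX ler_wpM2r ?exprn_ge0 //.
rewrite invfM !normrM !ler_pM ?mulr_ge0 //; first exact: Hq.
apply: Hc; rewrite mulrA normrM normrX ler_piMr // exprn_ile1 // ltW //.
Qed.

Lemma q_gauss A B q z : `|q| < 1 -> `|z| < 1 -> `|A * B * z| < 1 ->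
  qpochoo (A * B * z) q * qpochoo z q * limn (series (gauss_term A B q z))
  = qpochoo (A * z) q * qpochoo (B * z) q.
Proof.
move=> q1 z1 c1; have [M M0 HM] := gauss_term_bounded q1 c1.
have zk1 k : `|z * q ^+ k| < 1 by exact: norm_mulX_lt1.
have cvF k := cvgn_series_geometric_le (normr_ge0 _) (zk1 k) (HM k).
pose F k := limn (series (gauss_term A B q (z * q ^+ k))).
have recF k : (1 - A * B * z * q ^+ k) * (1 - z * q ^+ k) * F k
    = (1 - A * z * q ^+ k) * (1 - B * z * q ^+ k) * F k.+1.
  have ck1 : `|A * B * (z * q ^+ k)| < 1 by rewrite mulrA norm_mulX_lt1.
  apply/eqP; rewrite -subr_eq0; apply/eqP.
  set a1 := _ * (1 - z * q ^+ k); set a2 := _ * (1 - B * z * q ^+ k).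
  (* The contiguous relation is passed to the limit in n: [W] tends to the difference of the two
     sides, and its explicit remainder tends to 0. *)
  pose W n := a1 * series (gauss_term A B q (z * q ^+ k)) n
      - a2 * series (gauss_term A B q (z * q ^+ k.+1)) n.
  have L : W @ \oo --> a1 * F k - a2 * F k.+1.
    by apply: cvgB; apply: cvgM (cvF _); exact: cvg_cst.
  apply: (cvg_unique _ L); first exact: norm_hausdorff.
  have -> : W = fun n => - ((1 - q ^+ n) * (1 - A * B * (z * q ^+ k))
           * gauss_term A B q (z * q ^+ k) n).
    apply/funext => n; rewrite -gauss_contiguous //.
    by rewrite /W /a1 /a2 exprSr !mulrA.
  have -> : 0 = - ((1 - 0) * (1 - A * B * (z * q ^+ k)) * 0) :> Cplx R.
    by rewrite mulr0 oppr0.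
  apply: cvgN; apply: cvgM; last exact: cvg_series_cvg_0 (cvF k).
  apply: cvgM; last exact: cvg_cst.
  by apply: cvgB; [exact: cvg_cst | exact: cvgn_expr_lt1].
have iterF m : qpoch (A * B * z) q m * qpoch z q m * F 0
    = qpoch (A * z) q m * qpoch (B * z) q m * F m.
  elim: m => [|m IHm]; first by rewrite !qpoch0.
  rewrite !qpochS [LHS](_ : _ = (qpoch (A * B * z) q m * qpoch z q m * F 0)
      * ((1 - A * B * z * q ^+ m) * (1 - z * q ^+ m))); last by ring.
  rewrite IHm -mulrA [F m * _]mulrC recF; ring.
have F1 : F @ \oo --> (1 : Cplx R).
  apply: (@cvg_le_geometric _ _ _ (M * `|z| / (1 - `|z|)) `|q|) => // m.
  (* The term of index 0 is 1, so the tail bound from index 1 estimates F m - 1 by a multiple of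
     |zq^m|. *)
  have := series_tail_le 1 (normr_ge0 _) (zk1 m) (HM m).
  rewrite -/(F m) {1}seriesEnat /= big_nat1 {1}/gauss_term !qpoch0.
  rewrite !mulr1 divr1 expr1 => /le_trans; apply.
  rewrite normrM normrX -!mulrA ler_wpM2l ?(ltW M0) // ler_wpM2l //.
  rewrite [X in _ <= X]mulrC ler_wpM2l ?exprn_ge0 //.
  rewrite lef_pV2 ?posrE ?subr_gt0 //; last first.
    by have := zk1 m; rewrite normrM normrX.
  by rewrite lerD2l lerN2 ler_piMr // exprn_ile1 // ltW.
have zq0 : z * q ^+ 0 = z by rewrite expr0 mulr1.
have <- : F 0 = limn (series (gauss_term A B q z)) by rewrite /F zq0.
have L1 : (fun m => qpoch (A * B * z) q m * qpoch z q m * F 0) @ \oo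
    --> qpochoo (A * B * z) q * qpochoo z q * F 0.
  by apply: cvgM; [apply: cvgM; exact: cvgn_qpoch | exact: cvg_cst].
apply: (cvg_unique _ L1); first exact: norm_hausdorff.
rewrite (funext iterF).
rewrite -[qpochoo (A * z) q * _]mulr1; apply: cvgM F1.
by apply: cvgM; exact: cvgn_qpoch.
Qed.

End Gauss.

(** * The Bailey pair, by a telescoping certificate *)

Lemma sqrn_bin2 n : (n ^ 2 = 'C(n.+1, 2) + 'C(n, 2))%N.
Proof. by elim: n => [//|n IHn]; rewrite !binS !bin1 !bin0 in IHn *; lia. Qed.

Section BaileyPair.
Variable K : numFieldType.
Implicit Types (q : K) (r n : nat).

(* The two terms added at each step are those of index [j = m+1] and
   [j = -(m+1)] in the sum of [q^(-j(j+1)/2)] over [-n <= j <= n]. *)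
Fixpoint hecke_sum q n : K :=
  if n is m.+1 then hecke_sum q m + q ^- 'C(m.+2, 2) + q ^- 'C(m.+1, 2) else 1.

Definition bailey_alpha q r : K := (-1) ^+ r * q ^+ (r ^ 2 + r) * hecke_sum q r.

(* [1 / (q; q)_(n-r)] is [0] for [r > n]. *)
Definition bailey_weight q n r : K :=
  if (r <= n)%N then (qpoch q q (n - r) * qpoch q q (n + r).+1)^-1 else 0.

(** The certificate D_r. Its value 0 beyond r = n removes the upper boundary term of the summation
    by parts. *)
Definition bailey_cert q n r : K :=
  if (r <= n)%N then
    (-1) ^+ r * q ^+ (n + r ^ 2) / (qpoch q q (n - r) * qpoch q q (n + r))
  else 0.

(* Partial sums of [bailey_cert] against the increments of [hecke_sum]. *)
Definition bailey_psum q n r : K :=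
  if (r < n)%N then
    (-1) ^+ r * q ^+ (n + 'C(r.+1, 2))
    / ((1 - q ^+ n) * (qpoch q q (n - r.+1) * qpoch q q (n + r)))
  else 0.

Lemma bailey_weight_rec q n r : `|q| < 1 -> (r <= n.+1)%N ->
  (-1) ^+ r * q ^+ (r ^ 2 + r) *
    ((1 - q ^+ (2 * n.+1).+1) * bailey_weight q n.+1 r - bailey_weight q n r)
  = bailey_cert q n.+1 r - bailey_cert q n.+1 r.+1.
Proof.
move=> q1; rewrite /bailey_weight /bailey_cert => rn1; rewrite rn1.
have P0 k := qpoch_neq0 k q1 q1.
have s0 k : 1 - q * q ^+ k != 0 by rewrite subr1_neq0 // norm_mulX_lt1.
case: ltnP => [rn|nr].
  have rn' : (r <= n)%N by [].
  (* With n = r + d, only Pochhammer symbols of lengths d and 2r + d remain, up to explicit factors,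
     and the claim becomes a rational identity. *)
  rewrite rn'; have -> : n = (r + (n - r))%N by rewrite subnKC.
  move: (n - r)%N => d {rn rn' rn1}.
  have -> : ((r + d).+1 - r)%N = d.+1 by rewrite -addnS addKn.
  have -> : ((r + d).+1 - r.+1)%N = d by rewrite subSS addKn.
  have -> : ((r + d) - r)%N = d by rewrite addKn.
  have -> : ((r + d).+1 + r.+1)%N = (r + d + r).+2 by rewrite addnS addSn.
  rewrite !addSn !qpochS.
  have -> : (r.+1 ^ 2 = r ^ 2 + r + r + 1)%N by rewrite -addn1 sqrnD; lia.
  have -> : (2 * (r + d).+1 = r + d + r + d + 2)%N by lia.
  rewrite !(exprD, exprS).
  move: (P0 d) (P0 (r + d + r)%N) (s0 d) (s0 (r + d + r)%N) (s0 (r + d + r).+1).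
  rewrite !(exprD, exprS).
  move: (qpoch _ _ _) (qpoch _ _ _) (q ^+ r) (q ^+ d) (q ^+ (r ^ 2)) ((-1) ^+ r).
  by move=> x y u v w e *; field; apply/and5P.
(* At r = n + 1 the weight at n and the certificate at r + 1 both have their default value 0. *)
have {rn1 nr} -> : r = n.+1 by lia.
rewrite ltnn subnn qpoch0 qpochS addnn -mul2n (exprS q (2 * n.+1)).
have -> : (n.+1 ^ 2 + n.+1 = n.+1 + n.+1 ^ 2)%N by rewrite addnC.
by field; rewrite P0 s0.
Qed.

(** The last bracket is the increment of [hecke_sum] from r to r + 1; the step certifies the closed
    form of the partial sums. *)
Lemma bailey_psum_step q n r : q != 0 -> `|q| < 1 -> (r < n)%N ->
  bailey_psum q n r + bailey_cert q n r.+1 * (q ^- 'C(r.+2, 2) + q ^- 'C(r.+1, 2))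
  = bailey_psum q n r.+1.
Proof.
move=> q0 q1; rewrite /bailey_psum /bailey_cert => rn; rewrite rn.
have P0 k := qpoch_neq0 k q1 q1.
have s0 k : 1 - q * q ^+ k != 0 by rewrite subr1_neq0 // norm_mulX_lt1.
have -> : (r.+1 ^ 2 = 'C(r.+1, 2) + r.+1 + 'C(r.+1, 2))%N.
  by rewrite sqrn_bin2 binS bin1.
have -> : 'C(r.+2, 2) = ('C(r.+1, 2) + r.+1)%N by rewrite binS bin1.
case: n rn => // n; rewrite ltnS => rn; rewrite !subSS.
have -> : n = (r + (n - r))%N by rewrite subnKC.
move: (n - r)%N => d {rn}; rewrite !addKn.
move: 'C(r.+1, 2) => c.
have x0 m : q ^+ m != 0 by rewrite expf_neq0.
have -> : ((r + d).+1 + r = (r + d + r).+1)%N by lia.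
have -> : ((r + d).+1 + r.+1 = (r + d + r).+2)%N by lia.
rewrite (qpochS q q (r + d + r).+1) [q ^+ (r + d).+1]exprS.
(* For d = 0 the index r + 1 reaches the top, where [bailey_psum] is 0 by default: the certificate
   term cancels the preceding partial sum exactly. *)
case: d => [|d].
  rewrite addn0 ltnn qpoch0.
  move: (s0 r) (P0 (r + r).+1%N) (s0 (r + r).+1%N) (x0 c) (x0 r).
  rewrite !(exprD, exprS).
  move: (qpoch _ _ _) (q ^+ r) (q ^+ c) ((-1) ^+ r) => x u v e *.
  by field; do ![apply/andP; split=> //].
have -> : (r.+1 < (r + d.+1).+1)%N by lia.
have -> : (r + d.+1 - r.+1 = d)%N by lia.
rewrite (qpochS q q d).
move: (s0 (r + d.+1)%N) (s0 d) (P0 d) (P0 (r + d.+1 + r).+1) (s0 (r + d.+1 + r).+1).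
move: (x0 c) (x0 r).
rewrite !(exprD, exprS).
move: (qpoch _ _ _) (qpoch _ _ _) (q ^+ r) (q ^+ c) (q ^+ d) ((-1) ^+ r).
by move=> x y u v w e *; field; do ![apply/andP; split=> //].
Qed.

Lemma bailey_abel q n m : q != 0 -> `|q| < 1 -> (0 < n)%N -> (m <= n)%N ->
  \sum_(0 <= r < m.+1)
    (bailey_cert q n r - bailey_cert q n r.+1) * hecke_sum q r
  = bailey_psum q n m - bailey_cert q n m.+1 * hecke_sum q m.
Proof.
move=> q0 q1 n0; elim: m => [_|m IHm mn].
  (* Since [hecke_sum] starts at 1, the partial sums start with D_0 itself. *)
  rewrite big_nat1 /= !mulr1; congr (_ - _).
  rewrite /bailey_cert /bailey_psum n0 leq0n subn0 !addn0.
  case: n n0 => // n _; rewrite subSS subn0 qpochS exprS.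
  have s0 : 1 - q * q ^+ n != 0 by rewrite subr1_neq0 // norm_mulX_lt1.
  by have := qpoch_neq0 n q1 q1; rewrite expr0 => P0; field; rewrite P0 s0.
rewrite big_nat_recr //= IHm ?(ltnW mn) // -(bailey_psum_step q0 q1 mn); ring.
Qed.

Lemma bailey_pair q n : q != 0 -> `|q| < 1 ->
  \sum_(0 <= r < n.+1) bailey_weight q n r * bailey_alpha q r
  = (qpoch q (q ^+ 2) n.+1)^-1.
Proof.
move=> q0 q1; have q21 : `|q ^+ 2| < 1 by rewrite normrX exprn_ilt1.
elim: n => [|n IHn].
  rewrite big_nat1 /bailey_weight /bailey_alpha /= !qpochS !qpoch0.
  by rewrite !expr0 !mul1r !mulr1.
have Sn0 : 1 - q ^+ (2 * n.+1).+1 != 0 by rewrite subr1_neq0 // normrX exprn_ilt1.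
have zr : bailey_weight q n n.+1 = 0 by rewrite /bailey_weight ltnn.
(* The factor 1 - q^(2n+3) is the last one of (q; q^2)_(n+2); multiplying by it reduces the right
   side to the one at n. *)
apply: (mulfI Sn0); rewrite qpochS -exprM -exprS invfM [RHS]mulrCA divff // mulr1.
rewrite -IHn; apply/eqP; rewrite -subr_eq0; apply/eqP.
have -> : \sum_(0 <= r < n.+1) bailey_weight q n r * bailey_alpha q r
    = \sum_(0 <= r < n.+2) bailey_weight q n r * bailey_alpha q r.
  by rewrite [RHS]big_nat_recr //= zr mul0r addr0.
rewrite mulr_sumr -sumrB.
transitivity (\sum_(0 <= r < n.+2)
    (bailey_cert q n.+1 r - bailey_cert q n.+1 r.+1) * hecke_sum q r).
  apply: eq_big_nat => r /andP[_ rn]; rewrite -bailey_weight_rec //.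
  rewrite /bailey_alpha; ring.
(* At m = n + 1 both the closed partial sum and the boundary certificate are 0. *)
rewrite bailey_abel // /bailey_psum /bailey_cert !ltnn mul0r subr0 //.
Qed.

End BaileyPair.

(** * The terms of both series in Bailey form, and summability of alpha *)

Lemma bin2_mul2 n : ('C(n.+1, 2) * 2 = n.+1 * n)%N.
Proof. by elim: n => [//|n IHn]; rewrite binS bin1; lia. Qed.

Section Terms.
Variable K : numFieldType.
Implicit Types (q a b s : K).

(** The factor (rho_1)_n (rho_2)_n (q^2/(rho_1 rho_2))^n of Bailey's lemma relative to q. *)
Definition rho_weight a b q n : K :=
  qpoch (q / a) q n * qpoch (q / b) q n * (a * b) ^+ n.

Lemma hecke_sumE q n : q != 0 ->
  \sum_(0 <= k < n.*2.+1)
    q ^ (- ((k%:Z - n%:Z) * (k%:Z - n%:Z + 1) %/ 2)%Z) = hecke_sum q n.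
Proof.
(* The indices j = m and j = -(m+1) give the same product j(j+1), so one formula covers both end
   terms added in the induction. *)
move=> q0; have tri (m : nat) (j : int) : j * (j + 1) = m.+1%:Z * m%:Z ->
    q ^ (- (j * (j + 1) %/ 2)%Z) = q ^- 'C(m.+1, 2).
  by move=> ->; rewrite -PoszM -bin2_mul2 PoszM mulzK // exprnN.
elim: n => [|n IHn]; first by rewrite big_nat1 (tri 0%N) // bin_small // expr0 invr1.
rewrite doubleS big_nat_recl // big_nat_recr //= -IHn (tri n); last by lia.
rewrite (tri n.+1); last by lia.
rewrite [LHS]addrC; congr (_ + _ + _).
by apply: eq_bigr => k _; congr (q ^ (- ((_ * _) %/ 2)%Z)); lia.
Qed.

Lemma hecke_termE a b q n : q != 0 ->
  hecke_term a b q n = rho_weight a b q n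
    / (qpoch (a * q) q n * qpoch (b * q) q n) * bailey_alpha q n.
Proof.
move=> q0; rewrite /hecke_term /bailey_alpha -hecke_sumE // !mulr_sumr.
apply: eq_bigr => k _; rewrite /qpochs /rho_weight !big_cons !big_nil !mulr1.
by rewrite expfzDr // -exprnP (exprNn (a * b) n); ring.
Qed.

(** The upper parameter q cancels (q; q)_n, and the two lower parameters merge into (q^3; q^2)_n
    because s^6 = q^3. *)
Lemma phi32_termE a b q s n : `|q| < 1 -> s ^+ 2 = q ->
  phi32_term (q / a) (q / b) q (s ^+ 3) (- s ^+ 3) q (a * b) n
  = (1 - q) * (rho_weight a b q n / qpoch q (q ^+ 2) n.+1).
Proof.
move=> q1 sq; rewrite /phi32_term /qpochs !big_cons !big_nil !mulr1.
rewrite qpoch_mulN exprAC sq qpochSl -exprS.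
have q31 : `|q ^+ 3| < 1 by rewrite normrX exprn_ilt1.
have q21 : `|q ^+ 2| < 1 by rewrite normrX exprn_ilt1.
rewrite /rho_weight; field.
by rewrite subr1_neq0 // !qpoch_neq0.
Qed.

(** Reindexing by n = r + m exhibits the inner sum as a Gauss series with z = ab and ABz =
    q^(2r+2). *)
Lemma rho_weight_shift a b q r m : a != 0 -> b != 0 -> `|q| < 1 ->
  rho_weight a b q (r + m) * bailey_weight q (r + m) r
  = rho_weight a b q r / qpoch q q (r + r).+1
    * gauss_term (q / a * q ^+ r) (q / b * q ^+ r) q (a * b) m.
Proof.
move=> a0 b0 q1; rewrite /rho_weight /bailey_weight /gauss_term leq_addr addKn.
have -> : q / a * q ^+ r * (q / b * q ^+ r) * (a * b) = q * q ^+ (r + r).+1.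
  by rewrite exprS exprD; field; rewrite a0 b0.
have -> : (r + m + r).+1 = ((r + r).+1 + m)%N by lia.
rewrite !qpochD exprD.
have P0 := qpoch_neq0 _ q1 q1.
have P1 := qpoch_neq0 m (norm_mulX_lt1 (r + r).+1 q1 q1) q1.
by field; rewrite !P0 P1.
Qed.

(** The Gaussian factor beats the negative powers: (r+1)^2 + (r+1) is twice ['C(r.+2, 2)], so each
    of the two new terms keeps an exponent at least r. *)
Lemma bailey_alpha_le q r : q != 0 -> `|q| < 1 ->
  `|bailey_alpha q r.+1| <= `|q| * `|bailey_alpha q r| + 2 * `|q| ^+ r.
Proof.
move=> q0 q1; have q1' := ltW q1.
rewrite /bailey_alpha !normrM !normrX normrN1 !expr1n !mul1r /=.
set t := `|q| in q1' *; have t0 : 0 <= t by exact: normr_ge0.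
have tn0 : t != 0 by rewrite normr_eq0.
have te m n : (n <= m)%N -> t ^+ m <= t ^+ n by move=> ?; exact: ler_wiXn2l.
apply: (@le_trans _ _ (t ^+ (r.+1 ^ 2 + r.+1)
    * (`|hecke_sum q r| + t ^- 'C(r.+2, 2) + t ^- 'C(r.+1, 2)))).
  rewrite ler_wpM2l ?exprn_ge0 // (le_trans (ler_normD _ _)) //.
  rewrite (le_trans (lerD (ler_normD _ _) (lexx _))) //.
  by rewrite !normfV !normrX.
have E1 : (r.+1 ^ 2 + r.+1 = 'C(r.+2, 2) + 'C(r.+2, 2))%N.
  by rewrite sqrn_bin2 (binS r.+1) bin1; lia.
have E2 : ('C(r.+2, 2) = r.+1 + 'C(r.+1, 2))%N by rewrite binS bin1 addnC.
rewrite !mulrDr -addrA mulrA lerD //.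
  rewrite ler_wpM2r // -exprS te //.
  have -> : (r.+1 ^ 2 = r ^ 2 + r + r + 1)%N by rewrite -addn1 sqrnD; lia.
  lia.
rewrite mulr_natl mulr2n lerD // E1 exprD.
  by rewrite mulfK ?expf_neq0 // te // E2; lia.
rewrite -exprD {2}E2 addnA exprD mulfK ?expf_neq0 // te //; lia.
Qed.

(** The bound is the fixed point of S = 1 + |q| S + 2/(1 - |q|), so the recursive estimate preserves
    it. *)
Lemma sum_norm_bailey_alpha q n : q != 0 -> `|q| < 1 ->
  \sum_(0 <= r < n) `|bailey_alpha q r| <= (1 + 2 / (1 - `|q|)) / (1 - `|q|).
Proof.
move=> q0 q1; have d0 : 0 < 1 - `|q| by rewrite subr_gt0.
elim: n => [|n IHn].
  by rewrite big_nil divr_ge0 ?(ltW d0) // addr_ge0 // divr_ge0 ?(ltW d0).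
rewrite big_nat_recl // {1}/bailey_alpha /= !expr0 !mulr1 normr1.
apply: (@le_trans _ _ (1 + (`|q| * \sum_(0 <= r < n) `|bailey_alpha q r|
   + 2 * \sum_(0 <= r < n) `|q| ^+ r))).
  rewrite lerD2l !mulr_sumr -big_split /=.
  by apply: ler_sum => r _; exact: bailey_alpha_le.
apply: (@le_trans _ _ (1 + (`|q| * ((1 + 2 / (1 - `|q|)) / (1 - `|q|))
   + 2 * (1 / (1 - `|q|))))).
  rewrite lerD2l lerD ?ler_wpM2l //.
  exact: (sum_geometric_le 0 n (normr_ge0 q) q1).
by rewrite le_eqVlt; apply/orP; left; apply/eqP; field; rewrite gt_eqF.
Qed.

End Terms.

(** * Bailey's lemma relative to q *)

Section BaileyLemma.
Variable R : realType.
Local Open Scope classical_set_scope.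
Implicit Types (q x a b : Cplx R).

Lemma qpochooD x q m : `|q| < 1 ->
  qpochoo x q = qpoch x q m * qpochoo (x * q ^+ m) q.
Proof.
move=> q1.
have L : (fun n => qpoch x q (n + m)) @ \oo --> qpochoo x q.
  by rewrite (cvg_shiftn m (qpoch x q)); exact: cvgn_qpoch.
apply: (cvg_unique _ L); first exact: norm_hausdorff.
have -> : (fun n => qpoch x q (n + m))
    = (fun n => qpoch x q m * qpoch (x * q ^+ m) q n).
  by apply/funext => n; rewrite addnC qpochD.
by apply: cvgM; [exact: cvg_cst | exact: cvgn_qpoch].
Qed.

Lemma rho_weight_bounded a b q : `|q| < 1 ->
  exists2 M, 0 < M & forall n, `|rho_weight a b q n| <= M * `|a * b| ^+ n.
Proof.
move=> q1; have [Ma Ma0 Ha] := qpoch_bounded (q / a) q1.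
have [Mb Mb0 Hb] := qpoch_bounded (q / b) q1.
exists (Ma * Mb); first by rewrite mulr_gt0.
move=> n; rewrite /rho_weight normrM normrX ler_wpM2r ?exprn_ge0 //.
by rewrite normrM ler_pM.
Qed.

Lemma bailey_weight_bounded q : `|q| < 1 ->
  exists2 M, 0 < M & forall n r, `|bailey_weight q n r| <= M.
Proof.
move=> q1; have [M M0 HM] := qpochV_bounded (normr_ge0 q) q1 q1.
exists (M * M) => [|n r]; first by rewrite mulr_gt0.
rewrite /bailey_weight; case: ifP => _; last by rewrite normr0 mulr_ge0 // ltW.
by rewrite invfM normrM ler_pM // HM.
Qed.

Lemma lim_rho_weight a b q r : a != 0 -> b != 0 -> `|q| < 1 -> `|a * b| < 1 ->
  `|a * q| < 1 -> `|b * q| < 1 ->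
  limn (series (fun n => rho_weight a b q n * bailey_weight q n r))
  = qpochoo (a * q) q * qpochoo (b * q) q / (qpochoo q q * qpochoo (a * b) q)
    * (rho_weight a b q r / (qpoch (a * q) q r * qpoch (b * q) q r)).
Proof.
move=> a0 b0 q1 ab1 aq1 bq1.
set u := fun n => _; set A := q / a * q ^+ r; set B := q / b * q ^+ r.
have cE : A * B * (a * b) = q * q ^+ (r + r).+1.
  by rewrite /A /B exprS exprD; field; rewrite a0 b0.
have c1 : `|A * B * (a * b)| < 1 by rewrite cE norm_mulX_lt1.
have [M M0 HM] := gauss_term_bounded q1 c1.
have cvG : cvgn (series (gauss_term A B q (a * b))).
  apply: (cvgn_series_geometric_le (normr_ge0 _) ab1) => n.
  by have := HM 0 n; rewrite expr0 mulr1; exact.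
(* The weights vanish for n < r, so the partial sums shifted by r are those of the Gauss series. *)
have uE n : series u (n + r) = rho_weight a b q r / qpoch q q (r + r).+1
    * series (gauss_term A B q (a * b)) n.
  rewrite seriesEnat /= mulr_sumr (big_cat_nat _ (leq_addl n r)) //=.
  rewrite big1_seq ?add0r; last first.
    move=> k; rewrite mem_index_iota => /andP[_ /andP[_ kr]].
    by rewrite /u /bailey_weight leqNgt kr mulr0.
  rewrite -{1}[r]add0n big_addn addnK; apply: eq_bigr => k _.
  by rewrite /u addnC rho_weight_shift.
have L : (fun n => series u (n + r)) @ \oo
    --> rho_weight a b q r / qpoch q q (r + r).+1
    * limn (series (gauss_term A B q (a * b))).
  by rewrite (funext uE); apply: cvgM; [exact: cvg_cst | exact: cvG].
rewrite (cvg_shiftn r (series u)) in L.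
rewrite (cvg_lim _ L); last exact: norm_hausdorff.
move: (q_gauss q1 ab1 c1); rewrite cE.
(* Here Az = bq^(r+1) and Bz = aq^(r+1), so Gauss' products are tails of (bq)_oo and (aq)_oo. *)
have -> : A * (a * b) = b * q * q ^+ r by rewrite /A; field.
have -> : B * (a * b) = a * q * q ^+ r by rewrite /B; field.
rewrite (qpochooD (a * q) r q1) (qpochooD (b * q) r q1) (qpochooD q (r + r).+1 q1).
have Q0 : qpochoo (q * q ^+ (r + r).+1) q != 0.
  by rewrite qpochoo_neq0 // norm_mulX_lt1.
have Z0 := qpochoo_neq0 ab1 q1.
have P0 := qpoch_neq0 (r + r).+1 q1 q1.
have a_r0 := qpoch_neq0 r aq1 q1; have b_r0 := qpoch_neq0 r bq1 q1.
move: (limn _) (qpochoo _ _) (qpochoo _ _) Q0 Z0 => L' Q Z Q0 Z0 G.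
have -> : L' = qpochoo (b * q * q ^+ r) q * qpochoo (a * q * q ^+ r) q / (Q * Z).
  by rewrite -G; field; rewrite Q0 Z0.
by field; rewrite Q0 Z0 P0 a_r0 b_r0.
Qed.

Lemma bailey_lemma a b q (alpha : nat -> Cplx R) (M : Cplx R) :
  a != 0 -> b != 0 -> `|q| < 1 -> `|a * b| < 1 -> `|a * q| < 1 -> `|b * q| < 1 ->
  (forall n, \sum_(0 <= r < n) `|alpha r| <= M) ->
  let lhs n := rho_weight a b q n
    * \sum_(0 <= r < n.+1) bailey_weight q n r * alpha r in
  let rhs n := rho_weight a b q n
    / (qpoch (a * q) q n * qpoch (b * q) q n) * alpha n in
  [/\ cvgn (series lhs), cvgn (series rhs) &
     limn (series lhs)
     = qpochoo (a * q) q * qpochoo (b * q) q / (qpochoo q q * qpochoo (a * b) q)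
       * limn (series rhs)].
Proof.
move=> a0 b0 q1 ab1 aq1 bq1 alphaM lhs rhs.
have [Mr Mr0 Hr] := rho_weight_bounded a b q1.
have [Mw Mw0 Hw] := bailey_weight_bounded q1.
have [Ma Ma0 Ha] := qpochV_bounded (normr_ge0 _) aq1 q1.
have [Mb Mb0 Hb] := qpochV_bounded (normr_ge0 _) bq1 q1.
move: (ltW Mr0) (ltW Mw0) (ltW Ma0) (ltW Mb0) => Mr0' Mw0' Ma0' Mb0'.
set t := `|a * b| in ab1 Hr *; have t0 : 0 <= t by exact: normr_ge0.
have t1' : 0 < 1 - t by rewrite subr_gt0.
have M0 : 0 <= M by have := alphaM 0%N; rewrite big_nil.
set c := _ / (_ * _).
have uC r n : `|rho_weight a b q n * bailey_weight q n r| <= Mr * Mw * t ^+ n.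
  by rewrite normrM mulrAC ler_pM.
have cvlhs : cvgn (series lhs).
  apply: (@cvgn_series_geometric_le R _ (Mr * Mw * M) t) => // n.
  rewrite /lhs mulr_sumr (le_trans (ler_norm_sum _ _ _)) //.
  apply: (@le_trans _ _ (\sum_(0 <= r < n.+1) Mr * Mw * t ^+ n * `|alpha r|)).
    by apply: ler_sum => r _; rewrite mulrA normrM ler_wpM2r.
  by rewrite -mulr_sumr mulrAC ler_wpM2r ?exprn_ge0 // ler_wpM2l ?mulr_ge0.
have cvrhs : cvgn (series rhs).
  apply: (@cvgn_series_le R _ (Mr * (Ma * Mb) * M)) => n.
  apply: (@le_trans _ _ (\sum_(0 <= k < n) Mr * (Ma * Mb) * `|alpha k|)).
    apply: ler_sum => k _; rewrite /rhs normrM ler_wpM2r // normrM ler_pM //.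
      by rewrite (le_trans (Hr k)) // ler_piMr // exprn_ile1 // ltW.
    by rewrite invfM normrM ler_pM // ?Ha ?Hb.
  by rewrite -mulr_sumr ler_wpM2l ?mulr_ge0.
split=> //.
(* A finite exchange over r <= n < N; vanishing weights complete the triangle to a square. *)
have lhsE N : series lhs N = \sum_(0 <= r < N)
    series (fun n => rho_weight a b q n * bailey_weight q n r) N * alpha r.
  rewrite seriesEnat /=; under [RHS]eq_bigr do rewrite mulr_suml.
  rewrite exchange_big_nat /=; apply: eq_big_nat => n /andP[_ nN].
  rewrite /lhs mulr_sumr (big_cat_nat (leq0n n.+1) nN) /=.
  rewrite [X in _ + X]big1_seq ?addr0; last first.
    move=> r; rewrite mem_index_iota => /andP[_ /andP[nr _]].
    by rewrite /bailey_weight leqNgt nr mulr0 mul0r.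
  by apply: eq_bigr => r _; rewrite mulrA.
(* Replacing each truncated inner sum by its limit costs at most a constant times |ab|^N, uniformly
   in r; the bound on the sums of |alpha r| makes the total error tend to 0. *)
have L0 : (fun N => series lhs N - c * series rhs N) @ \oo --> (0 : Cplx R).
  apply: (@cvg_le_geometric R _ _ (Mr * Mw / (1 - t) * M) t) => // N.
  rewrite subr0 lhsE [series rhs]seriesEnat /= mulr_sumr -sumrB.
  rewrite (le_trans (ler_norm_sum _ _ _)) //.
  apply: (@le_trans _ _ (\sum_(0 <= r < N) Mr * Mw / (1 - t) * t ^+ N * `|alpha r|)).
    apply: ler_sum => r _; set u := fun n => rho_weight a b q n * _.
    have -> : c * rhs r = limn (series u) * alpha r.
      by rewrite lim_rho_weight // -/c /rhs !mulrA.
    rewrite -mulrBl normrM ler_wpM2r // distrC mulrAC.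
    exact: (series_tail_le N t0 ab1 (uC r)).
  rewrite -mulr_sumr mulrAC ler_wpM2r ?exprn_ge0 //.
  by rewrite ler_wpM2l ?divr_ge0 ?mulr_ge0 ?(ltW t1').
have L1 : (fun N => series lhs N - c * series rhs N) @ \oo
    --> limn (series lhs) - c * limn (series rhs).
  by apply: cvgB; [exact: cvlhs | apply: cvgM; [exact: cvg_cst | exact: cvrhs]].
apply/eqP; rewrite -subr_eq0; apply/eqP.
by apply: (cvg_unique _ L1 L0); exact: norm_hausdorff.
Qed.

End BaileyLemma.

(** * The identity from the Bailey pair and Bailey's lemma *)

Lemma qpochoos2 (K : numFieldType) (x y q : K) :
  qpochoos [:: x; y] q = qpochoo x q * qpochoo y q.
Proof. by rewrite /qpochoos !big_cons big_nil mulr1. Qed.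

Theorem theorem4p6 (R : realType) (q a b s : Cplx R)
    (hq0 : q != 0) (ha0 : a != 0) (hb0 : b != 0)
    (hq1 : `|q| < 1)
    (hmax : Num.max `|a * b| (Num.max `|a * q| `|b * q|) < 1)
    (hs : s ^+ 2 = q) :
  [/\ {in [:: q; a * b; a * q; b * q], forall x, cvgn (qpoch x q)},
      qpochoos [:: a * q; b * q] q != 0,
      cvgn (series (phi32_term (q / a) (q / b) q (s ^+ 3) (- s ^+ 3) q (a * b))),
      cvgn (series (hecke_term a b q)) &
      qpochoos [:: q; a * b] q / qpochoos [:: a * q; b * q] q
        * phi32 (q / a) (q / b) q (s ^+ 3) (- s ^+ 3) q (a * b)
      = (1 - q) * limn (series (hecke_term a b q))].
Proof.
have /and3P[ab1 aq1 bq1] : [&& `|a * b| < 1, `|a * q| < 1 & `|b * q| < 1].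
  (* The order on complex numbers is only partial; the maximum splits because norms are real and
     hence comparable. *)
  move: hmax; rewrite comparable_gt_max; last first.
    by apply: real_comparable; rewrite ?max_real ?normr_real.
  by rewrite comparable_gt_max // real_comparable // normr_real.
have aq0 := qpochoo_neq0 aq1 hq1; have bq0 := qpochoo_neq0 bq1 hq1.
have ab0 := qpochoo_neq0 ab1 hq1; have qq0 := qpochoo_neq0 hq1 hq1.
pose lhs n := rho_weight a b q n / qpoch q (q ^+ 2) n.+1.
have lhsE : (fun n => rho_weight a b q n
    * \sum_(0 <= r < n.+1) bailey_weight q n r * bailey_alpha q r) = lhs.
  by apply/funext => n; rewrite bailey_pair.
have heckeE : (fun n => rho_weight a b q n
    / (qpoch (a * q) q n * qpoch (b * q) q n) * bailey_alpha q n)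
    = hecke_term a b q.
  by apply/funext => n; rewrite hecke_termE.
have [] := bailey_lemma ha0 hb0 hq1 ab1 aq1 bq1
  (fun n => sum_norm_bailey_alpha n hq0 hq1).
rewrite lhsE heckeE => cvl cvr E.
have phiE : phi32_term (q / a) (q / b) q (s ^+ 3) (- s ^+ 3) q (a * b)
    = (1 - q) *: (lhs : (Cplx R)^nat).
  by apply/funext => n; rewrite phi32_termE.
split.
- by move=> x _; exact: cvgn_qpoch.
- rewrite qpochoos2; exact: mulf_neq0 aq0 bq0.
- by rewrite phiE; exact: is_cvg_seriesZ cvl.
- exact: cvr.
rewrite /phi32 phiE (lim_seriesZ _ cvl) E !qpochoos2 -[_ *: _]/(_ * _).
move: (qpochoo _ _) (qpochoo _ _) (qpochoo _ _) (qpochoo _ _) aq0 bq0 ab0 qq0.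
move: (limn _) => L A B C D A0 B0 C0 D0.
by field; apply/and4P.
Qed.
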